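(* For each integer $m\ge1$ and each $\ell\in(0,1)$, the function $\alpha\mapsto R_m(\alpha)$ (defined in the context) is strictly convex on $[0,1]$. Its unique minimizer $\alpha_\ell(m)\in[0,1]$ is such that $\alpha_\ell(m)=1$ if $\ell\le\frac12$, and $\alpha_\ell(m)\in(\frac12,1)$ if $\ell>\frac12$.
   Context: With $\sigma=\sqrt\ell$, $\ell_\alpha=1-\alpha+\alpha\ell$ and $K(\alpha,\theta)=(1-\alpha)^2+2\alpha(1-\alpha)\sigma\cos\theta+\alpha^2\sigma^2$, for $\alpha\in[0,1]$ define $$R_m(\alpha)=(1-\ell)\,\ell_\alpha^{\,m}+\frac{2\ell}{\pi}\int_0^\pi\frac{K(\alpha,\theta)^m\sin^2\theta}{1-2\sigma\cos\theta+\sigma^2}\,d\theta .$$ (This is a polynomial in $\alpha$.) *)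

(* Defs.v *)
(* Classical real numbers of the Stdlib, with Coquelicot's Riemann integral. *)
From Stdlib Require Import Reals.
From Coquelicot Require Import Coquelicot.

Open Scope R_scope.

Definition ell_alpha (l alpha : R) : R := 1 - alpha + alpha * l.

Definition K (l alpha theta : R) : R :=
  (1 - alpha) ^ 2 + 2 * alpha * (1 - alpha) * sqrt l * cos theta
  + alpha ^ 2 * sqrt l ^ 2.

(* For 0 < l < 1 the denominator below is at least (1 - sqrt l) ^ 2 > 0, so the
   integrand is continuous on [0, PI] and the total operator RInt returns its
   Riemann integral. *)
Definition R_m (l : R) (m : nat) (alpha : R) : R :=
  (1 - l) * ell_alpha l alpha ^ m
  + 2 * l / PI *
    RInt (fun theta => K l alpha theta ^ m * sin theta ^ 2
                       / (1 - 2 * sqrt l * cos theta + sqrt l ^ 2))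
         0 PI.

Definition strictly_convex_on (a b : R) (f : R -> R) : Prop :=
  forall x y t : R,
    a <= x <= b -> a <= y <= b -> x <> y -> 0 < t < 1 ->
    f (t * x + (1 - t) * y) < t * f x + (1 - t) * f y.

Definition is_minimizer_on (a b : R) (f : R -> R) (x : R) : Prop :=
  a <= x <= b /\ forall y : R, a <= y <= b -> f x <= f y.

(* Main.v *)
(* Both [ell_alpha l alpha] and [K l alpha theta] are nonnegative and convex in
   alpha, the latter strictly, so R_m is strictly convex; the position of its
   minimizer is then read off the signs of two derivatives.  At alpha = 1/2 both
   [ell_alpha l] and [K l _ theta] have negative derivative l - 1, so
   R_m'(1/2) < 0.  At alpha = 1 the factor K^(m-1) is the constant l^(m-1), and
   the weight has integral PI/2, which gives R_m'(1) = m l^(m-1) (2 l - 1). *)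

Require Import Defs.
From Stdlib Require Import Reals Lra Lia.
From Coquelicot Require Import Coquelicot.

Open Scope R_scope.

(** * Convexity of powers on the nonnegative reals *)

Lemma pow_lt_compat_l (n : nat) (x y : R) :
  (1 <= n)%nat -> 0 <= x < y -> x ^ n < y ^ n.
Proof.
  intros hn [hx hxy].
  destruct n as [|n]; [lia|clear hn].
  induction n as [|n IH]; [simpl; lra|].
  change (x * x ^ S n < y * y ^ S n).
  apply Rmult_le_0_lt_compat; trivial.
  now apply pow_le.
Qed.

(** Induction through Chebyshev's inequality: [x - y] and [x ^ n - y ^ n] have the same sign, and
    the average of the products exceeds the product of the averages by
    [t * (1 - t) * (x - y) * (x ^ n - y ^ n)]. *)
Lemma pow_convex (n : nat) (x y t : R) :
  0 <= x -> 0 <= y -> 0 <= t <= 1 ->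
  (t * x + (1 - t) * y) ^ n <= t * x ^ n + (1 - t) * y ^ n.
Proof.
  intros hx hy ht.
  induction n as [|n IH]; [simpl; lra|]; simpl.
  assert (hcheb : 0 <= (x - y) * (x ^ n - y ^ n)).
  { destruct (Rle_dec x y) as [h|h].
    - assert (x ^ n <= y ^ n) by (apply pow_incr; lra). nra.
    - assert (y ^ n <= x ^ n) by (apply pow_incr; lra). nra. }
  assert (hz : 0 <= t * x + (1 - t) * y) by nra.
  assert (ht' : 0 <= t * (1 - t)) by nra.
  apply Rle_trans with ((t * x + (1 - t) * y) * (t * x ^ n + (1 - t) * y ^ n)).
  - now apply Rmult_le_compat_l.
  - pose proof (Rmult_le_pos _ _ ht' hcheb). nra.
Qed.

(** The strictness comes from [f] and survives because the power is strictly increasing; the power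
    itself contributes only weak convexity. *)
Lemma strictly_convex_on_pow (a b : R) (f : R -> R) (n : nat) :
  (1 <= n)%nat -> (forall x, a <= x <= b -> 0 <= f x) ->
  strictly_convex_on a b f -> strictly_convex_on a b (fun x => f x ^ n).
Proof.
  intros hn hf hconv x y t hx hy hxy ht.
  apply Rlt_le_trans with ((t * f x + (1 - t) * f y) ^ n).
  - apply pow_lt_compat_l; [exact hn|split; [apply hf; nra|now apply hconv]].
  - apply pow_convex; [now apply hf|now apply hf|lra].
Qed.

(** * First-order conditions on an interval *)

(** Secants are tested only for [t] in (0, 1), in the direction [v], so the bound also applies at an
    endpoint of an interval with [v] pointing inwards. *)
Lemma is_derive_le_secant (f : R -> R) (x v d c : R) :
  is_derive f x d -> (forall t, 0 < t < 1 -> f (x + t * v) - f x <= t * c) ->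
  d * v <= c.
Proof.
  intros hd hsec.
  assert (hg : is_derive (fun t => f (x + t * v)) 0 (d * v)).
  { evar_last.
    - apply (is_derive_comp f (fun t => x + t * v)).
      + replace (x + 0 * v) with x by ring. exact hd.
      + auto_derive; [trivial|reflexivity].
    - unfold scal; simpl; unfold mult; simpl; ring. }
  apply is_derive_Reals in hg.
  apply Rnot_lt_le; intro hlt.
  (* Within this tolerance of [d * v], the difference quotient would exceed [c]. *)
  destruct (hg (d * v - c)) as [delta hdelta]; [lra|].
  pose proof (cond_pos delta) as hpos.
  set (t := Rmin (delta / 2) (1 / 2)).
  assert (ht : 0 < t) by (apply Rmin_pos; lra).
  assert (ht1 : t <= delta / 2) by apply Rmin_l.
  assert (ht2 : t <= 1 / 2) by apply Rmin_r.
  assert (hq : Rabs ((f (x + (0 + t) * v) - f (x + 0 * v)) / t - d * v)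
               < d * v - c).
  { apply hdelta; [lra|]. rewrite Rabs_right; lra. }
  replace (x + 0 * v) with x in hq by ring.
  rewrite Rplus_0_l in hq.
  apply Rabs_def2 in hq. destruct hq as [_ hq].
  assert (h : (f (x + t * v) - f x) / t <= c).
  { apply Rle_div_l; [exact ht|].
    rewrite (Rmult_comm c t). apply hsec. lra. }
  lra.
Qed.

(** From a minimizer, the secants of [- f] towards [y] have increments at most 0. The sign condition
    therefore covers minimizers at an endpoint. *)
Lemma is_minimizer_on_derive (a b x y d : R) (f : R -> R) :
  is_minimizer_on a b f x -> is_derive f x d -> a <= y <= b ->
  0 <= d * (y - x).
Proof.
  intros [hx hmin] hd hy.
  assert (h : - d * (y - x) <= 0).
  { apply is_derive_le_secant with (f := fun u => - f u) (x := x).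
    - apply (is_derive_opp f x d hd).
    - intros t ht.
      assert (f x <= f (x + t * (y - x))) by (apply hmin; nra).
      lra. }
  lra.
Qed.

(** The secant bound alone gives a weak inequality. It is applied at the midpoint [z], and strict
    convexity between [x] and [y] then makes it strict. *)
Lemma strictly_convex_on_tangent (a b x y d : R) (f : R -> R) :
  strictly_convex_on a b f -> is_derive f x d ->
  a <= x <= b -> a <= y <= b -> x <> y -> f x + d * (y - x) < f y.
Proof.
  intros hf hd hx hy hxy.
  set (z := 1 / 2 * x + (1 - 1 / 2) * y).
  assert (hz : f z < 1 / 2 * f x + (1 - 1 / 2) * f y)
    by (apply hf; trivial; lra).
  assert (hxz : x <> z) by (unfold z; lra).
  assert (h : d * (z - x) <= f z - f x).
  { apply is_derive_le_secant with (1 := hd).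
    intros t ht.
    replace (x + t * (z - x)) with (t * z + (1 - t) * x) by ring.
    assert (f (t * z + (1 - t) * x) < t * f z + (1 - t) * f x)
      by (apply hf; unfold z in *; lra).
    lra. }
  unfold z in *. lra.
Qed.

Lemma strictly_convex_on_minimizer_unique (a b x y : R) (f : R -> R) :
  strictly_convex_on a b f ->
  is_minimizer_on a b f x -> is_minimizer_on a b f y -> x = y.
Proof.
  intros hf [hx hxmin] [hy hymin].
  destruct (Req_dec x y) as [h|h]; [exact h|exfalso].
  assert (hz : f (1 / 2 * x + (1 - 1 / 2) * y)
               < 1 / 2 * f x + (1 - 1 / 2) * f y)
    by (apply hf; trivial; lra).
  assert (f x <= f (1 / 2 * x + (1 - 1 / 2) * y)) by (apply hxmin; lra).
  assert (f y <= f x) by now apply hymin.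
  lra.
Qed.

(** * The weight and the kernel [K] *)

Definition weight (l theta : R) : R :=
  sin theta ^ 2 / (1 - 2 * sqrt l * cos theta + sqrt l ^ 2).

Definition dK (l alpha theta : R) : R :=
  - 2 * (1 - alpha) + 2 * (1 - 2 * alpha) * sqrt l * cos theta
  + 2 * alpha * sqrt l ^ 2.

Lemma sqrt_bounds (l : R) :
  0 < l < 1 -> 0 < sqrt l < 1 /\ sqrt l ^ 2 = l.
Proof.
  intros hl. split; [split|].
  - apply sqrt_lt_R0; lra.
  - rewrite <- sqrt_1. apply sqrt_lt_1; lra.
  - apply pow2_sqrt; lra.
Qed.

Lemma weight_denom_pos (l theta : R) :
  0 < l < 1 -> 0 < 1 - 2 * sqrt l * cos theta + sqrt l ^ 2.
Proof.
  intros hl. destruct (sqrt_bounds l hl) as [hs _].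
  pose proof (COS_bound theta). nra.
Qed.

Lemma weight_pos (l theta : R) :
  0 < l < 1 -> 0 < theta < PI -> 0 < weight l theta.
Proof.
  intros hl ht. apply Rdiv_lt_0_compat; [|now apply weight_denom_pos].
  apply pow_lt, sin_gt_0; lra.
Qed.

Lemma continuous_weight (l theta : R) :
  0 < l < 1 -> continuous (weight l) theta.
Proof.
  intros hl. apply (ex_derive_continuous (weight l)). unfold weight. auto_derive.
  pose proof (weight_denom_pos l theta hl). simpl in *. lra.
Qed.

(** [K l alpha theta] is the squared modulus of the complex number [1 - alpha + alpha * sqrt l * exp
    (i * theta)]. *)
Lemma K_ge0 (l alpha theta : R) : 0 <= K l alpha theta.
Proof.
  pose proof (sin2_cos2 theta) as h. unfold Rsqr in h.
  replace (K l alpha theta)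
    with ((1 - alpha + alpha * sqrt l * cos theta) ^ 2
          + (alpha * sqrt l * sin theta) ^ 2).
  - apply Rplus_le_le_0_compat; apply pow2_ge_0.
  - unfold K.
    replace (alpha ^ 2 * sqrt l ^ 2)
      with (alpha ^ 2 * sqrt l ^ 2
            * (sin theta * sin theta + cos theta * cos theta))
      by (rewrite h; ring).
    ring.
Qed.

(** [K] is quadratic in [alpha], and its leading coefficient is exactly the positive denominator of
    the weight. *)
Lemma K_strictly_convex (l theta : R) :
  0 < l < 1 -> strictly_convex_on 0 1 (fun alpha => K l alpha theta).
Proof.
  intros hl x y t _ _ hxy ht.
  pose proof (weight_denom_pos l theta hl) as hD.
  apply Rlt_0_minus.
  replace (_ - _)
    with (t * (1 - t) * (x - y) ^ 2
          * (1 - 2 * sqrt l * cos theta + sqrt l ^ 2))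
    by (unfold K; ring).
  apply Rmult_lt_0_compat; [|exact hD].
  apply Rmult_lt_0_compat; [nra|].
  apply pow2_gt_0. lra.
Qed.

Lemma is_derive_K (l alpha theta : R) :
  is_derive (fun a => K l a theta) alpha (dK l alpha theta).
Proof. unfold K, dK. auto_derive; [trivial|ring]. Qed.

Lemma continuous_K (l alpha theta : R) : continuous (K l alpha) theta.
Proof.
  apply (ex_derive_continuous (K l alpha)). unfold K. now auto_derive.
Qed.

(** * Joint continuity and differentiation under the integral sign *)

Lemma continuity_2d_pt_pow (f : R -> R -> R) (n : nat) (x y : R) :
  continuity_2d_pt f x y -> continuity_2d_pt (fun u v => f u v ^ n) x y.
Proof.
  intros hf. apply (continuity_1d_2d_pt_comp (fun z => z ^ n)); [|exact hf].
  apply derivable_continuous_pt, derivable_pt_pow.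
Qed.

(** Common shape of [K] and [dK]: polynomials in [alpha] of degree at most 2 with coefficients
    continuous in [theta]. *)
Lemma continuity_2d_pt_affine_sqr (p q r : R -> R) (x y : R) :
  continuity_pt p y -> continuity_pt q y -> continuity_pt r y ->
  continuity_2d_pt (fun u v => p v + q v * u + r v * u ^ 2) x y.
Proof.
  intros hp hq hr.
  assert (lift : forall g, continuity_pt g y ->
                 continuity_2d_pt (fun _ v : R => g v) x y).
  { intros g hg. apply (continuity_1d_2d_pt_comp g (fun _ v => v)); trivial.
    apply continuity_2d_pt_id2. }
  repeat apply continuity_2d_pt_plus; repeat apply continuity_2d_pt_mult;
    auto using continuity_2d_pt_id1, continuity_2d_pt_const.
Qed.

Lemma continuous_integrand (l alpha theta : R) (n : nat) :
  0 < l < 1 -> continuous (fun t => K l alpha t ^ n * weight l t) theta.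
Proof.
  intros hl. apply (continuous_mult (fun t => K l alpha t ^ n) (weight l)).
  - apply (continuous_comp (K l alpha) (fun z => z ^ n)).
    + apply continuous_K.
    + apply (ex_derive_continuous (fun z => z ^ n)). now auto_derive.
  - now apply continuous_weight.
Qed.

Lemma ex_RInt_integrand (l alpha : R) (n : nat) :
  0 < l < 1 -> ex_RInt (fun t => K l alpha t ^ n * weight l t) 0 PI.
Proof.
  intros hl. apply (ex_RInt_continuous (fun t => K l alpha t ^ n * weight l t)).
  intros z _. now apply continuous_integrand.
Qed.

Definition dintegrand (l : R) (m : nat) (alpha theta : R) : R :=
  INR m * dK l alpha theta * K l alpha theta ^ pred m * weight l theta.

Lemma is_derive_integrand (l alpha theta : R) (m : nat) :
  is_derive (fun a => K l a theta ^ m * weight l theta) alpha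
    (dintegrand l m alpha theta).
Proof.
  evar_last.
  - apply (is_derive_mult (fun a => K l a theta ^ m) (fun _ => weight l theta)).
    + apply is_derive_pow, is_derive_K.
    + apply is_derive_const.
    + intros; apply Rmult_comm.
  - unfold dintegrand, plus, mult, zero; simpl. ring.
Qed.

Lemma continuity_2d_pt_dintegrand (l alpha theta : R) (m : nat) :
  0 < l < 1 -> continuity_2d_pt (dintegrand l m) alpha theta.
Proof.
  intros hl. unfold dintegrand.
  assert (hcos : forall c d, continuity_pt (fun t => c + d * cos t) theta).
  { intros c d. apply continuity_pt_filterlim.
    apply (ex_derive_continuous (fun t => c + d * cos t)). now auto_derive. }
  apply continuity_2d_pt_mult;
    [apply continuity_2d_pt_mult; [apply continuity_2d_pt_mult|]|].
  - apply continuity_2d_pt_const.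
  (* Each coefficient is written as [c + d * cos v], with zeros where necessary, so that [hcos]
     applies to it. *)
  - apply continuity_2d_pt_ext
      with (fun u v => (- 2 + 2 * sqrt l * cos v)
              + (2 + 2 * sqrt l ^ 2 + - 4 * sqrt l * cos v) * u
              + (0 + 0 * cos v) * u ^ 2).
    + intros; unfold dK; ring.
    + now apply continuity_2d_pt_affine_sqr.
  - apply continuity_2d_pt_pow.
    apply continuity_2d_pt_ext
      with (fun u v => (1 + 0 * cos v) + (- 2 + 2 * sqrt l * cos v) * u
              + (1 + sqrt l ^ 2 + - 2 * sqrt l * cos v) * u ^ 2).
    + intros; unfold K; ring.
    + now apply continuity_2d_pt_affine_sqr.
  - apply (continuity_1d_2d_pt_comp (weight l) (fun _ v => v)).
    + apply continuity_pt_filterlim. now apply continuous_weight.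
    + apply continuity_2d_pt_id2.
Qed.

Lemma continuous_dintegrand (l alpha theta : R) (m : nat) :
  0 < l < 1 -> continuous (dintegrand l m alpha) theta.
Proof.
  intros hl. apply continuity_pt_filterlim.
  intros eps heps.
  destruct (continuity_2d_pt_dintegrand l alpha theta m hl (mkposreal eps heps))
    as [d hd].
  exists d. split; [apply cond_pos|].
  intros x [_ hx]. apply hd; [|exact hx].
  rewrite Rminus_diag, Rabs_R0. apply cond_pos.
Qed.

Definition dR_m (l : R) (m : nat) (alpha : R) : R :=
  (1 - l) * (INR m * (l - 1) * ell_alpha l alpha ^ pred m)
  + 2 * l / PI * RInt (dintegrand l m alpha) 0 PI.

Lemma R_m_weight (l alpha : R) (m : nat) :
  R_m l m alpha = (1 - l) * ell_alpha l alpha ^ m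
    + 2 * l / PI * RInt (fun t => K l alpha t ^ m * weight l t) 0 PI.
Proof.
  unfold R_m. do 2 f_equal. apply RInt_ext.
  intros t _. unfold weight, Rdiv. apply Rmult_assoc.
Qed.

(** Leibniz's rule, justified by the joint continuity of [dintegrand l m]. *)
Lemma is_derive_R_m (l alpha : R) (m : nat) :
  0 < l < 1 -> is_derive (R_m l m) alpha (dR_m l m alpha).
Proof.
  intros hl.
  assert (hD : forall u v,
    Derive (fun a => K l a v ^ m * weight l v) u = dintegrand l m u v)
    by (intros; apply is_derive_unique, is_derive_integrand).
  eapply is_derive_ext; [intro a; symmetry; apply R_m_weight|].
  apply (is_derive_plus (fun a => (1 - l) * ell_alpha l a ^ m)).
  - apply (is_derive_scal (fun a => ell_alpha l a ^ m)).
    apply is_derive_pow. unfold ell_alpha. auto_derive; [trivial|ring].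
  - apply (is_derive_scal
             (fun a => RInt (fun t => K l a t ^ m * weight l t) 0 PI)).
    (* [is_derive_RInt_param] expresses the derivative through [Derive], hence the change of
       integrand. *)
    rewrite (RInt_ext (dintegrand l m alpha)
      (fun t => Derive (fun a => K l a t ^ m * weight l t) alpha))
      by (intros; symmetry; apply hD).
    apply (is_derive_RInt_param (fun a t => K l a t ^ m * weight l t)).
    + apply filter_forall. intros a t _. eexists. apply is_derive_integrand.
    + intros t _. apply continuity_2d_pt_ext with (dintegrand l m).
      * intros; symmetry; apply hD.
      * now apply continuity_2d_pt_dintegrand.
    + apply filter_forall. intros a. now apply ex_RInt_integrand.
Qed.

(** * Strict convexity under the integral *)

(** Strictness comes from the integral: [ell_alpha l] is affine, so its power gives only a weak
    inequality, while the integrands compare strictly inside the interval. *)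
Lemma R_m_strictly_convex (l : R) (m : nat) :
  (1 <= m)%nat -> 0 < l < 1 -> strictly_convex_on 0 1 (R_m l m).
Proof.
  intros hm hl x y t hx hy hxy ht.
  set (z := t * x + (1 - t) * y).
  rewrite !R_m_weight.
  set (I := fun a => RInt (fun th => K l a th ^ m * weight l th) 0 PI).
  change (RInt _ 0 PI) with (I z) at 1.
  change (RInt _ 0 PI) with (I x) at 1.
  change (RInt _ 0 PI) with (I y) at 1.
  assert (hell : ell_alpha l z ^ m
                 <= t * ell_alpha l x ^ m + (1 - t) * ell_alpha l y ^ m).
  { replace (ell_alpha l z)
      with (t * ell_alpha l x + (1 - t) * ell_alpha l y)
      by (unfold z, ell_alpha; ring).
    apply pow_convex; unfold ell_alpha; nra. }
  assert (hI : I z < t * I x + (1 - t) * I y).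
  { replace (t * I x + (1 - t) * I y)
      with (RInt (fun th => plus (scal t (K l x th ^ m * weight l th))
                   (scal (1 - t) (K l y th ^ m * weight l th))) 0 PI).
    2:{ apply is_RInt_unique.
        apply (is_RInt_plus (V := R_NormedModule));
          apply (is_RInt_scal (V := R_NormedModule));
          apply (RInt_correct (V := R_CompleteNormedModule));
          now apply ex_RInt_integrand. }
    apply RInt_lt.
    - apply PI_RGT_0.
    - intros th _.
      apply (continuous_plus (fun th => scal t (K l x th ^ m * weight l th))
               (fun th => scal (1 - t) (K l y th ^ m * weight l th)));
        apply (continuous_scal_r _ (fun th => K l _ th ^ m * weight l th));
        now apply continuous_integrand.
    - intros th _. now apply continuous_integrand.
    (* The comparison is made on the open interval only: the weight vanishes at 0 and [PI]. *)
    - intros th hth. unfold plus, scal; simpl; unfold mult; simpl.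
      pose proof (weight_pos l th hl hth) as hw.
      assert (h : K l z th ^ m < t * K l x th ^ m + (1 - t) * K l y th ^ m).
      { apply (strictly_convex_on_pow 0 1 (fun a => K l a th)); trivial.
        - intros; apply K_ge0.
        - now apply K_strictly_convex. }
      apply (Rmult_lt_compat_r _ _ _ hw) in h. lra. }
  assert (hc : 0 < 2 * l / PI)
    by (apply Rdiv_lt_0_compat; [lra|apply PI_RGT_0]).
  apply (Rmult_lt_compat_l _ _ _ hc) in hI.
  apply (Rmult_le_compat_l (1 - l)) in hell; [|lra].
  lra.
Qed.

(** * Closed forms of two integrals *)

(* [t + 2 atan (s sin t / (1 - s cos t))], with [s = sqrt l], is a primitive of
   the Poisson kernel [(1 - s^2) / (1 - 2 s cos t + s^2)]; the other terms come
   from dividing [sin t ^ 2 = 1 - cos t ^ 2] by the denominator. *)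
Definition weight_primitive (l t : R) : R :=
  sin t / (2 * sqrt l) + t / 2
  - (1 - sqrt l ^ 2) / (2 * sqrt l ^ 2)
    * atan (sqrt l * sin t / (1 - sqrt l * cos t)).

Lemma is_derive_weight_primitive (l t : R) :
  0 < l < 1 -> is_derive (weight_primitive l) t (weight l t).
Proof.
  intros hl. destruct (sqrt_bounds l hl) as [hs _].
  pose proof (weight_denom_pos l t hl) as hD.
  pose proof (COS_bound t) as hc.
  unfold weight_primitive, weight.
  set (s := sqrt l) in *. clearbody s.
  assert (hsc : 0 < 1 - s * cos t) by nra.
  assert (hsin : sin t ^ 2 = 1 - cos t ^ 2)
    by (pose proof (sin2_cos2 t) as h; unfold Rsqr in h; lra).
  auto_derive; [lra|].
  (* This identity makes the derivative of the arctangent a fraction over the denominator of the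
     weight; what remains is rational algebra modulo [hsin]. *)
  assert (hden : (1 - s * cos t) ^ 2 + s ^ 2 * sin t ^ 2
                 = 1 - 2 * s * cos t + s ^ 2) by (rewrite hsin; ring).
  set (S := sin t) in *. set (c := cos t) in *. clearbody S c.
  replace (1 + s * S * / (1 + - (s * c)) * (s * S * / (1 + - (s * c)) * 1))
    with ((1 - 2 * s * c + s ^ 2) / (1 - s * c) ^ 2)
    by (rewrite <- hden; field; lra).
  field_simplify_eq; [|repeat split; lra].
  ring_simplify.
  rewrite ?hsin. ring_simplify.
  nra.
Qed.

(** At both ends the sine vanishes and the arctangent with it, so only the term [t / 2] of the
    primitive contributes. *)
Lemma is_RInt_weight (l : R) :
  0 < l < 1 -> is_RInt (weight l) 0 PI (PI / 2).
Proof.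
  intros hl. destruct (sqrt_bounds l hl) as [hs _].
  replace (PI / 2) with (minus (weight_primitive l PI) (weight_primitive l 0)).
  - apply (is_RInt_derive (weight_primitive l) (weight l)).
    + intros t _. now apply is_derive_weight_primitive.
    + intros t _. now apply continuous_weight.
  - unfold weight_primitive, minus, plus, opp; simpl.
    rewrite sin_PI, sin_0, cos_PI, cos_0.
    replace (sqrt l * 0 / (1 - sqrt l * -1)) with 0 by (field; lra).
    replace (sqrt l * 0 / (1 - sqrt l * 1)) with 0 by (field; lra).
    rewrite atan_0. field. lra.
Qed.

Lemma is_RInt_sin_sqr : is_RInt (fun t => sin t ^ 2) 0 PI (PI / 2).
Proof.
  replace (PI / 2)
    with (minus ((PI - sin PI * cos PI) / 2) ((0 - sin 0 * cos 0) / 2)).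
  - apply (is_RInt_derive (fun t => (t - sin t * cos t) / 2)
             (fun t => sin t ^ 2)).
    + intros t _. auto_derive; [trivial|].
      pose proof (sin2_cos2 t) as h. unfold Rsqr in h. nra.
    + intros t _. apply (ex_derive_continuous (fun t => sin t ^ 2)).
      now auto_derive.
  - unfold minus, plus, opp; simpl. rewrite sin_PI, sin_0. field.
Qed.

(** * Slopes at 1 and at 1/2 *)

(** Up to the factor [INR m * l ^ pred m], the integral term contributes [l ^ 2] and the other term
    [- (1 - l) ^ 2]; their sum is [2 * l - 1]. *)
Lemma dR_m_1 (l : R) (m : nat) :
  0 < l < 1 -> dR_m l m 1 = INR m * l ^ pred m * (2 * l - 1).
Proof.
  intros hl. destruct (sqrt_bounds l hl) as [_ hs].
  assert (hI : RInt (dintegrand l m 1) 0 PI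
               = INR m * l ^ pred m * (l * (PI / 2))).
  { apply is_RInt_unique.
    evar_last.
    - (* [dK l 1 theta] is the denominator of the weight plus [l - 1] *)
      apply is_RInt_ext with
        (fun t => scal (INR m * l ^ pred m)
                    (plus (sin t ^ 2) (scal (l - 1) (weight l t)))).
      + intros t _.
        unfold dintegrand, weight, dK, K, plus, scal; simpl; unfold mult; simpl.
        pose proof (weight_denom_pos l t hl) as hD. simpl in hs, hD.
        replace ((1 - 1) * ((1 - 1) * 1) + 2 * 1 * (1 - 1) * sqrt l * cos t
                 + 1 * (1 * 1) * (sqrt l * (sqrt l * 1))) with l
          by (rewrite hs; ring).
        rewrite hs in *. field. lra.
      + apply (is_RInt_scal (V := R_NormedModule)).
        apply (is_RInt_plus (V := R_NormedModule)); [apply is_RInt_sin_sqr|].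
        apply (is_RInt_scal (V := R_NormedModule)). now apply is_RInt_weight.
    - unfold plus, scal; simpl; unfold mult; simpl. field. }
  unfold dR_m. rewrite hI.
  replace (ell_alpha l 1) with l by (unfold ell_alpha; ring).
  field. apply PI_neq0.
Qed.

Lemma dR_m_half_neg (l : R) (m : nat) :
  (1 <= m)%nat -> 0 < l < 1 -> dR_m l m (1 / 2) < 0.
Proof.
  intros hm hl. destruct (sqrt_bounds l hl) as [hs hsl].
  assert (hmpos : 0 < INR m) by (apply lt_0_INR; lia).
  assert (hell : 0 < INR m * ell_alpha l (1 / 2) ^ pred m).
  { apply Rmult_lt_0_compat; [exact hmpos|].
    apply pow_lt. unfold ell_alpha. lra. }
  assert (hI : RInt (dintegrand l m (1 / 2)) 0 PI < 0).
  { replace 0 with (RInt (fun _ => 0) 0 PI) at 2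
      by (rewrite RInt_const; unfold scal; simpl; unfold mult; simpl; ring).
    apply RInt_lt.
    - apply PI_RGT_0.
    - intros; apply continuous_const.
    - intros; now apply continuous_dintegrand.
    - intros t ht. unfold dintegrand.
      replace (dK l (1 / 2) t) with (l - 1) by (unfold dK; rewrite hsl; field).
      pose proof (weight_pos l t hl ht) as hw.
      (* Here [K] is a quarter of [1 + 2 * sqrt l * cos t + sqrt l ^ 2], hence at least
         [(1 - sqrt l) ^ 2 / 4]. *)
      assert (hK : 0 < K l (1 / 2) t).
      { pose proof (COS_bound t). unfold K. nra. }
      pose proof (pow_lt _ (pred m) hK) as hKp.
      assert (0 < INR m * K l (1 / 2) t ^ pred m * weight l t)
        by (apply Rmult_lt_0_compat; [now apply Rmult_lt_0_compat|exact hw]).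
      nra. }
  assert (hc : 0 < 2 * l / PI)
    by (apply Rdiv_lt_0_compat; [lra|apply PI_RGT_0]).
  unfold dR_m.
  assert (0 < (1 - l) * (1 - l) * (INR m * ell_alpha l (1 / 2) ^ pred m))
    by (apply Rmult_lt_0_compat; [nra|exact hell]).
  assert (2 * l / PI * RInt (dintegrand l m (1 / 2)) 0 PI < 0) by nra.
  lra.
Qed.

(** * Existence, uniqueness and position of the minimizer *)

Theorem proposition10 (m : nat) (l : R) (hm : (1 <= m)%nat) (hl : 0 < l < 1) :
  strictly_convex_on 0 1 (R_m l m) /\
  (exists! alpha : R, is_minimizer_on 0 1 (R_m l m) alpha) /\
  (forall alpha : R, is_minimizer_on 0 1 (R_m l m) alpha ->
     (l <= 1 / 2 -> alpha = 1) /\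
     (1 / 2 < l -> 1 / 2 < alpha < 1)).
Proof.
  pose proof (R_m_strictly_convex l m hm hl) as hconv.
  pose proof (is_derive_R_m l 1 m hl) as hd1.
  pose proof (is_derive_R_m l (1 / 2) m hl) as hdh.
  pose proof (dR_m_half_neg l m hm hl) as hneg.
  rewrite (dR_m_1 l m hl) in hd1.
  assert (hc : 0 < INR m * l ^ pred m).
  { apply Rmult_lt_0_compat; [apply lt_0_INR; lia|apply pow_lt; lra]. }
  set (c := INR m * l ^ pred m) in *.
  split; [exact hconv|split].
  - destruct (continuity_ab_min (R_m l m) 0 1) as [alpha [hmin halpha]].
    + lra.
    + intros a _. apply continuity_pt_filterlim.
      apply (ex_derive_continuous (R_m l m)).
      eexists. now apply is_derive_R_m.
    + exists alpha. split; [now split|].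
      intros beta hbeta.
      apply (strictly_convex_on_minimizer_unique 0 1 alpha beta (R_m l m));
        trivial.
      now split.
  - intros alpha hmin. pose proof hmin as [halpha hle]. split; intro hl2.
    (* The slope at 1 is at most 0, so the tangent there is at least [R_m l m 1] to the left of 1.
       The strict tangent inequality also settles [l = 1 / 2], where this slope is 0. *)
    + destruct (Req_dec alpha 1) as [h|h]; [exact h|exfalso].
      assert (htan : R_m l m 1 + c * (2 * l - 1) * (alpha - 1) < R_m l m alpha)
        by (apply (strictly_convex_on_tangent 0 1); trivial; lra).
      assert (R_m l m alpha <= R_m l m 1) by (apply hle; lra).
      assert (c * (2 * l - 1) <= 0) by nra.
      assert (0 <= c * (2 * l - 1) * (alpha - 1)) by nra.
      lra.
    + split.
      * apply Rnot_le_lt; intro h.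
        (* The tangent inequality needs two distinct points, so [alpha = 1 / 2] is excluded
           separately, by moving towards 1 along the negative slope. *)
        destruct (Req_dec alpha (1 / 2)) as [->|h'].
        -- assert (0 <= dR_m l m (1 / 2) * (1 - 1 / 2))
             by (eapply is_minimizer_on_derive; [exact hmin|exact hdh|lra]).
           lra.
        -- assert (htan : R_m l m (1 / 2) + dR_m l m (1 / 2) * (alpha - 1 / 2)
                          < R_m l m alpha)
             by (apply (strictly_convex_on_tangent 0 1); trivial; lra).
           assert (R_m l m alpha <= R_m l m (1 / 2)) by (apply hle; lra).
           assert (0 <= dR_m l m (1 / 2) * (alpha - 1 / 2)) by nra.
           lra.
      (* At 1 the slope is now positive, so moving towards 0 contradicts minimality. *)
      * apply Rnot_le_lt; intro h.
        assert (h1 : alpha = 1) by lra. subst alpha.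
        assert (0 <= c * (2 * l - 1) * (0 - 1))
          by (eapply is_minimizer_on_derive; [exact hmin|exact hd1|lra]).
        assert (0 < c * (2 * l - 1)) by (apply Rmult_lt_0_compat; lra).
        lra.
Qed.
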